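(* Let $f:(0,\infty)\times(0,\infty)\to\mathbb{R}$ be a function with $f(x,y)>0$ for all $x,y>0$. Suppose that $f$ is homogeneous, i.e. $f(kx,ky)=f(x,y)$ for all $k>0$ and all $x,y>0$, and that $f$ is integrable in $x$, i.e. $x\mapsto f(x,1)$ is Riemann integrable on $[0,1]$. Put $c=\int_0^1 f(x,1)\,dx$. Then, as $N\to\infty$ through the positive integers, $$\sum_{n\le N} f(n,N)\log n\sim cN\log N,$$ where the sum runs over integers $1\le n\le N$.
   Context: The notation $A(N)\sim B(N)$ means $A(N)/B(N)\to 1$ as $N\to\infty$. The value assigned to $f(0,1)$ is immaterial; Riemann integrability on $[0,1]$ is understood for the function $x\mapsto f(x,1)$ extended by any value at $x=0$. *)

(* Defs.v *)
From Stdlib Require Import Reals.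
From Coquelicot Require Import Coquelicot.
Open Scope R_scope.

(* Division in [R] is total, so the finitely many [n] with [B n = 0]
   (such as [n = 1] when [B n = c * n * ln n]) do not affect the limit. *)
Definition asymp_equiv (A B : nat -> R) : Prop :=
  is_lim_seq (fun n => A n / B n) 1.

(* A function on (0,oo) x (0,oo) is represented by a total function on [R];
   its values off the open quadrant are left unconstrained. *)
Definition positive_on_quadrant (f : R -> R -> R) : Prop :=
  forall x y : R, 0 < x -> 0 < y -> 0 < f x y.

Definition homogeneous_on_quadrant (f : R -> R -> R) : Prop :=
  forall k x y : R, 0 < k -> 0 < x -> 0 < y -> f (k * x) (k * y) = f x y.

(* The arbitrary value [f 0 1] is the extension of [x |-> f x 1] to [x = 0]. *)
Definition integrable_in_x (f : R -> R -> R) : Prop :=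
  ex_RInt (fun x => f x 1) 0 1.

(* Main.v *)
(** By homogeneity [f n N = g (n / N)] with [g x = f x 1], and
    [ln n = ln N + ln (n / N)].  The [ln N] part is [N ln N] times a uniform
    Riemann sum of [g], which tends to [c]; as [g] is bounded by some [M] and
    [ln N! >= N ln N - N], the other part is at most [M N], which is negligible.
    Dividing by [c] requires [c > 0].  If the integral of the positive function
    [g] vanished, then every subinterval would contain a smaller one on which
    [g <= 1/(n+1)] (otherwise tags with [g > 1/(n+1)] would give large Riemann
    sums), and at a common point of such nested intervals [g] could not be
    positive. *)

Require Import Defs.
From Stdlib Require Import Reals Lra Lia Classical IndefiniteDescription.
From mathcomp Require Import ssreflect ssrbool seq.
From Coquelicot Require Import Coquelicot.
Open Scope R_scope.

(** The tag is an arbitrary function of the cell's endpoints, so that both right endpoints and tags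
    picked by choice are covered. *)
Lemma is_lim_seq_Riemann_sum_unif (g : R -> R) (a b : R) (tag : R -> R -> R) :
  a < b -> ex_RInt g a b ->
  (forall x y, x <= y -> x <= tag x y <= y) ->
  is_lim_seq (fun n => Riemann_sum g (SF_seq_f2 tag (unif_part a b n)))
    (RInt g a b).
Proof.
move=> ltab /RInt_correct intg tagP.
suff fine : filterlim (fun n => SF_seq_f2 tag (unif_part a b n))
    eventually (Riemann_fine a b).
  have : filterlim (fun ptd => Riemann_sum g ptd)
      (Riemann_fine a b) (locally (RInt g a b)).
    move: intg; apply: filterlim_ext => ptd.
    rewrite sign_eq_1; last lra.
    exact: scal_one.
  exact: filterlim_comp fine.
move=> P [d Pd].
have dpos := cond_pos d.
have quo : 0 < (b - a) / d by apply: Rdiv_lt_0_compat; lra.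
(* With [n0] the floor of [(b - a) / d], the mesh [(b - a) / (n + 1)] is below [d] for all
   [n >= n0]. *)
have [n0 [_ n0d]] := nfloor_ex _ (Rlt_le _ _ quo).
exists n0 => n /le_INR n0n.
have [step [ptd [h l]]] := Riemann_fine_unif_part tag a b n tagP (Rlt_le _ _ ltab).
apply: Pd; last by rewrite Rmin_left ?Rmax_right; try lra; split.
apply: Rle_lt_trans step _.
have n1 := pos_INR n.
apply/Rlt_div_l; first lra.
by move/Rlt_div_l: n0d => /(_ dpos); nra.
Qed.

Lemma Riemann_sum_mkseq (g : R -> R) (tag : R -> R -> R) (p : nat -> R) (n : nat) :
  Riemann_sum g (SF_seq_f2 tag (mkseq p (S n))) =
  sum_n_m (fun i => (p i - p (Nat.pred i)) * g (tag (p (Nat.pred i)) (p i))) 1 n.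
Proof.
have mkseqS (q : nat -> R) m :
    mkseq q (S m) = q 0%nat :: mkseq (fun i => q (S i)) m.
  by rewrite /mkseq /= (iotaDl 1 0 m) -map_comp.
elim: n p => [|n IHn] p.
  by rewrite sum_n_m_zero //; lia.
rewrite mkseqS SF_cons_f2; last by rewrite size_mkseq; lia.
rewrite Riemann_sum_cons IHn [in RHS]sum_Sn_m; last lia.
rewrite -[in RHS]sum_n_m_S; congr plus.
case: n {IHn} => [|n]; first by rewrite !sum_n_m_zero; try lia.
(* [S (Nat.pred k)] and [Nat.pred (S k)] differ only at [k = 0], outside the range. *)
by apply: sum_n_m_ext_loc => -[|k] hk; first lia.
Qed.

Lemma sum_n_m_le_loc (u v : nat -> R) (n m : nat) :
  (forall k, (n <= k <= m)%nat -> u k <= v k) ->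
  sum_n_m u n m <= sum_n_m v n m.
Proof.
move=> uv.
(* The maximum agrees with [v] on the range and dominates [u] at every index. *)
rewrite (sum_n_m_ext_loc v (fun k => Rmax (u k) (v k))).
  by apply: sum_n_m_le => k; apply: Rmax_l.
by move=> k /uv uvk; rewrite Rmax_right.
Qed.

Lemma sum_n_m_Rmult_l (a : R) (u : nat -> R) (n m : nat) :
  sum_n_m (fun k => a * u k) n m = a * sum_n_m u n m.
Proof. exact: (sum_n_m_mult_l (K := R_Ring)). Qed.

Lemma exists_subinterval_le (g : R -> R) (a b eps : R) :
  a < b -> ex_RInt g a b -> RInt g a b < eps * (b - a) ->
  exists a' b', a < a' /\ a' < b' /\ b' < b /\
    forall x, a' <= x <= b' -> g x <= eps.
Proof.
move=> ltab intg ltint; apply: NNPP => noint.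
(* If no such interval exists, every nondegenerate cell inside [[a, b]] has a tag with [g >= eps];
   choice collects these tags into one function. *)
have [[x y] /=|tag tagP] := functional_choice (fun (p : R * R) t =>
    fst p <= snd p -> fst p <= t <= snd p /\
    (a <= fst p -> fst p < snd p -> snd p <= b -> eps <= g t)).
  have [lex|nlex] := classic (x <= y); last by exists x.
  have [[ax [xy yb]]|nin] := classic (a <= x /\ x < y /\ y <= b); last first.
    by exists x => _; split; [lra | move=> *; case: nin].
  apply: NNPP => notag; apply: noint.
  (* The middle third of [[x, y]] makes the inclusion in [[a, b]] strict at both ends. *)
  exists ((2 * x + y) / 3), ((x + 2 * y) / 3); do 3 (split; first lra).
  move=> z hz; apply: Rnot_lt_le => ltz; apply: notag.
  by exists z => _; split => *; lra.
pose t x y := tag (x, y).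
have tP x y : x <= y -> x <= t x y <= y by move=> /(tagP (x, y)) [].
have := is_lim_seq_Riemann_sum_unif g a b t ltab intg tP.
have lower n : eps * (b - a) <= Riemann_sum g (SF_seq_f2 t (unif_part a b n)).
  have n0 := pos_INR n.
  rewrite Riemann_sum_mkseq.
  have -> : eps * (b - a) = sum_n_m (fun _ => (b - a) / (INR n + 1) * eps) 1 (S n).
    rewrite sum_n_m_const Nat.sub_1_r Nat.pred_succ S_INR; field; lra.
  apply: sum_n_m_le_loc => -[|i] hi; first lia.
  have step : a + INR (S i) * (b - a) / (INR n + 1)
     - (a + INR i * (b - a) / (INR n + 1)) = (b - a) / (INR n + 1).
    rewrite S_INR; field; lra.
  have stepp : 0 < (b - a) / (INR n + 1) by apply: Rdiv_lt_0_compat; lra.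
  rewrite -[Nat.pred _]/i step; apply: Rmult_le_compat_l; first lra.
  apply: (proj2 (tagP (_, _) _)); rewrite /fst /snd; try lra.
  + have := pos_INR i => i0.
    suff : 0 <= INR i * (b - a) / (INR n + 1) by lra.
    apply: Rdiv_le_0_compat; nra.
  + have /le_INR : (S i <= S n)%nat by lia.
    rewrite !S_INR => hin.
    suff : (INR i + 1) * (b - a) / (INR n + 1) <= b - a by lra.
    apply/Rle_div_l; nra.
move=> lim.
have /= := is_lim_seq_le _ _ _ _ lower (is_lim_seq_const _) lim.
lra.
Qed.

Lemma RInt_pos (g : R -> R) (a b : R) :
  a < b -> ex_RInt g a b -> (forall x, a < x < b -> 0 < g x) ->
  0 < RInt g a b.
Proof.
move=> ltab intg gpos; apply: Rnot_le_lt => intle.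
pose inside (p : R * R) := a <= fst p /\ fst p < snd p /\ snd p <= b.
have intg' x y : a <= x -> x <= y -> y <= b -> ex_RInt g x y.
  move=> ax xy yb; apply: (ex_RInt_Chasles_2 _ a); first lra.
  by apply: (ex_RInt_Chasles_1 _ _ _ b); [lra|].
have ge0 x y : a <= x -> x <= y -> y <= b -> 0 <= RInt g x y.
  move=> ax xy yb; apply: RInt_ge_0 => //; first exact: intg'.
  by move=> z hz; apply/Rlt_le/gpos; lra.
(* The two outer pieces have nonnegative integrals, so the middle one inherits the bound [<= 0];
   this lets the shrinking step be repeated. *)
have int0 p : inside p -> RInt g (fst p) (snd p) <= 0.
  case: p => x y [/= ax [xy yb]].
  have [ig1 ig2] : ex_RInt g a x /\ ex_RInt g x b by split; apply: intg'; lra.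
  have [ig3 ig4] : ex_RInt g x y /\ ex_RInt g y b by split; apply: intg'; lra.
  have := RInt_Chasles g a x b ig1 ig2; have := RInt_Chasles g x y b ig3 ig4.
  rewrite /plus /=.
  have := ge0 a x ltac:(lra) ltac:(lra) ltac:(lra).
  have := ge0 y b ltac:(lra) ltac:(lra) ltac:(lra).
  lra.
(* The stage [n] is passed along with the interval, since the bound [1 / (n + 1)] imposed on the
   next interval depends on it. *)
have [[n [x y]] /=|next nextP] := functional_choice
    (fun (np : nat * (R * R)) (q : R * R) =>
      inside (snd np) -> fst (snd np) < fst q /\ fst q < snd q /\
      snd q < snd (snd np) /\
      forall x, fst q <= x <= snd q -> g x <= / (INR (fst np) + 1)).
  have [ins|] := classic (inside (x, y)); last by exists (x, y).
  have [ax [xy yb]] := ins; rewrite /= in ax xy yb.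
  have npos : 0 < / (INR n + 1).
    by apply: Rinv_0_lt_compat; have := pos_INR n; lra.
  have [||x' [y' xyP]] := exists_subinterval_le g x y (/ (INR n + 1)) xy.
  - by apply: intg'; lra.
  - by have /= := int0 _ ins; nra.
  by exists (x', y').
pose I := fix I n := if n is S m then next (m, I m) else (a, b).
have insI n : inside (I n).
  elim: n => [|n IHn]; first by rewrite /inside /=; lra.
  have := nextP (n, I n) IHn; move: IHn; rewrite /inside /=; lra.
have IS n : fst (I n) < fst (I (S n)) /\ fst (I (S n)) < snd (I (S n)) /\
    snd (I (S n)) < snd (I n) /\
    forall x, fst (I (S n)) <= x <= snd (I (S n)) -> g x <= / (INR n + 1).
  exact: (nextP (n, I n) (insI n)).
have nest n k : fst (I n) <= fst (I (n + k)%nat) /\ snd (I (n + k)%nat) <= snd (I n).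
  elim: k => [|k]; first by rewrite Nat.add_0_r; lra.
  have := IS (n + k)%nat; rewrite Nat.add_succ_r /=; lra.
have cross n m : fst (I n) <= snd (I m).
  have [_ [? _]] := insI (n + m)%nat.
  have [? _] := nest n m; have [_] := nest m n.
  rewrite Nat.add_comm; lra.
(* The supremum of the left endpoints lies in every interval. *)
have [|x [xub xlub]] := completeness (EUn (fun n => fst (I n))) _ (EUn_noempty _).
  by exists b => _ [n ->]; have := cross n 0%nat.
have xin n : fst (I n) <= x <= snd (I n).
  split; first by apply: xub; exists n.
  by apply: xlub => _ [m ->].
have gx0 : 0 < g x.
  (* Positivity is known only on the open interval, and [I 1] lies strictly inside [(a, b)]. *)
  apply: gpos; have := xin 1%nat.
  have := IS 0%nat; rewrite /=; lra.
have [n [nlt /lt_0_INR npos]] := archimed_cor1 _ gx0.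
have [_ [_ [_ /(_ _ (xin (S n))) gle]]] := IS n.
have : / (INR n + 1) < / INR n by apply: Rinv_lt_contravar; nra.
lra.
Qed.

(** A weak Stirling bound. From [x] to [x + 1] the left side grows by
    [ln (x + 1) + x * ln (1 + 1/x) - 1], which is at most [ln (x + 1)] because
    [ln (1 + 1/x) <= 1/x]. *)
Lemma sum_ln_lower (N : nat) :
  INR N * ln (INR N) - INR N <= sum_n_m (fun n => ln (INR n)) 1 N.
Proof.
elim: N => [|N IHN]; first by rewrite sum_n_m_zero /zero /=; [lra | lia].
rewrite sum_n_Sm; last lia.
apply: Rle_trans (Rplus_le_compat_r _ _ _ IHN).
case: N {IHN} => [|N]; first by rewrite /= ln_1; lra.
have Npos : 0 < INR (S N) by apply: lt_0_INR; lia.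
rewrite (S_INR (S N)); set x := INR (S N) in Npos *.
have [xinv quo] : 0 < / x /\ 0 < (x + 1) / x.
  by split; [apply: Rinv_0_lt_compat | apply: Rdiv_lt_0_compat]; lra.
have lnle : ln (x + 1) - ln x <= / x.
  rewrite -ln_div; try lra.
  rewrite -[X in _ <= X](ln_exp (/ x)); apply: ln_le => //.
  have -> : (x + 1) / x = 1 + / x by field; lra.
  exact/Rlt_le/exp_ineq1/Rgt_not_eq.
have : x * (ln (x + 1) - ln x) <= 1.
  rewrite -[X in _ <= X](Rinv_r x); last lra.
  by apply: Rmult_le_compat_l; lra.
rewrite /plus /=; lra.
Qed.

(** These are right-endpoint Riemann sums, so the value [g 0] never enters. The index is shifted
    because [unif_part 0 1 N] has [N + 1] cells. *)
Lemma is_lim_seq_unif_average (g : R -> R) :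
  ex_RInt g 0 1 ->
  is_lim_seq (fun N => sum_n_m (fun n => g (INR n / INR N)) 1 N / INR N)
    (RInt g 0 1).
Proof.
move=> intg; apply/is_lim_seq_incr_1.
have := is_lim_seq_Riemann_sum_unif g 0 1 (fun _ y => y) Rlt_0_1 intg _.
move=> /(_ (fun x y xy => conj xy (Rle_refl y))).
apply: is_lim_seq_ext => N.
have N0 := pos_INR N.
rewrite Riemann_sum_mkseq /Rdiv Rmult_comm -sum_n_m_Rmult_l.
apply: sum_n_m_ext_loc => -[|n] hn; first lia.
rewrite -[Nat.pred _]/n (S_INR N) (S_INR n) /=; congr (_ * g _); field; lra.
Qed.

(** The difference is the sum of [w (n/N) * (ln n - ln N)]. Each [ln n - ln N] is nonpositive, so
    absolute values add up to at most [M * (N ln N - ln N!)]. *)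
Lemma sum_ln_weighted_le (w : R -> R) (M : R) (N : nat) :
  (0 < N)%nat -> (forall x, 0 < x <= 1 -> Rabs (w x) <= M) ->
  Rabs (sum_n_m (fun n => w (INR n / INR N) * ln (INR n)) 1 N
        - ln (INR N) * sum_n_m (fun n => w (INR n / INR N)) 1 N) <= M * INR N.
Proof.
move=> /lt_0_INR N0 wM.
have M0 : 0 <= M by apply: Rle_trans (wM 1 _); [apply: Rabs_pos | lra].
set u := fun n => w _.
have -> : sum_n_m (fun n => u n * ln (INR n)) 1 N
    = ln (INR N) * sum_n_m u 1 N
      + sum_n_m (fun n => u n * (ln (INR n) - ln (INR N))) 1 N.
  rewrite -sum_n_m_Rmult_l -[RHS](sum_n_m_plus (G := R_AbelianMonoid)).
  by apply: sum_n_m_ext => n; rewrite /plus /mult /=; ring.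
rewrite Rplus_minus_l.
apply: Rle_trans (norm_sum_n_m (V := R_NormedModule) _ _ _) _.
apply: (Rle_trans _ (M * (ln (INR N) * INR N - sum_n_m (fun n => ln (INR n)) 1 N))).
  have -> : ln (INR N) * INR N - sum_n_m (fun n => ln (INR n)) 1 N
      = sum_n_m (fun n => ln (INR N) + - 1 * ln (INR n)) 1 N.
    rewrite (sum_n_m_plus (G := R_AbelianMonoid)) sum_n_m_const.
    rewrite sum_n_m_Rmult_l /plus Nat.sub_1_r /=; ring.
  rewrite -sum_n_m_Rmult_l.
  apply: sum_n_m_le_loc => n [/le_INR n1 /le_INR nN]; rewrite /= in n1.
  have lnn : ln (INR n) <= ln (INR N) by apply: ln_le => //; lra.
  rewrite /norm /= /abs /= /mult /= Rabs_mult (Rabs_left1 (_ - _)); last lra.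
  have -> : - (ln (INR n) - ln (INR N)) = ln (INR N) + - 1 * ln (INR n) by ring.
  apply: Rmult_le_compat_r; first lra.
  apply: wM; split; first by apply: Rdiv_lt_0_compat; lra.
  by apply/Rle_div_l; lra.
by apply: Rmult_le_compat_l => //; have := sum_ln_lower N; lra.
Qed.

Theorem lemma1p1 (f : R -> R -> R) (c : R)
  (f_pos : positive_on_quadrant f)
  (f_hom : homogeneous_on_quadrant f)
  (f_int : integrable_in_x f)
  (c_def : c = RInt (fun x => f x 1) 0 1) :
  asymp_equiv
    (fun N : nat =>
       sum_n_m (fun n : nat => f (INR n) (INR N) * ln (INR n)) 1 N)
    (fun N : nat => c * INR N * ln (INR N)).
Proof.
set g := fun x => f x 1 in c_def.
have c0 : 0 < c.
  by rewrite c_def; apply: RInt_pos => // [|x hx]; [lra | apply: f_pos; lra].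
have [M gM] : exists M, forall x, 0 < x <= 1 -> Rabs (g x) <= M.
  have [M gM] := ex_RInt_ub _ _ _ f_int.
  exists M => x hx; apply: gM; rewrite Rmin_left ?Rmax_right; lra.
pose S N := sum_n_m (fun n => g (INR n / INR N)) 1 N.
pose A N := sum_n_m (fun n => g (INR n / INR N) * ln (INR n)) 1 N.
have lnlim : is_lim_seq (fun N => ln (INR N)) p_infty.
  apply: filterlim_comp is_lim_ln_p.
  exact: is_lim_seq_INR.
have errlim : is_lim_seq (fun N => M / c * / ln (INR N)) 0.
  have -> : Finite 0 = Rbar_mult (M / c) (Rbar_inv p_infty).
    by rewrite /= Rmult_0_r.
  by apply/is_lim_seq_scal_l/is_lim_seq_inv.
have avglim : is_lim_seq (fun N => / c * (S N / INR N)) 1.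
  have -> : Finite 1 = Rbar_mult (/ c) c by rewrite /= Rinv_l //; lra.
  by apply: is_lim_seq_scal_l; rewrite c_def; apply: is_lim_seq_unif_average.
have lower := is_lim_seq_minus' _ _ _ _ avglim errlim.
have upper := is_lim_seq_plus' _ _ _ _ avglim errlim.
rewrite Rminus_0_r in lower; rewrite Rplus_0_r in upper.
(* The quotient is squeezed between [S N / (c N) - M / (c ln N)] and [S N / (c N) + M / (c ln N)];
   starting at [N = 2] makes [ln N] positive. *)
apply: (is_lim_seq_le_le_loc _ _ _ _ _ lower upper).
exists 2%nat => N N2.
have N0 : 2 <= INR N by apply: (le_INR 2).
have L0 : 0 < ln (INR N) by rewrite -ln_1; apply: ln_increasing; lra.
have -> : sum_n_m (fun n => f (INR n) (INR N) * ln (INR n)) 1 N = A N.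
  apply: sum_n_m_ext_loc => n [/le_INR n1 _]; rewrite /= in n1.
  have quo : 0 < INR n / INR N by apply: Rdiv_lt_0_compat; lra.
  (* Homogeneity with factor [N] takes [(n/N, 1)] to [(n, N)]. *)
  rewrite /g -(f_hom (INR N) _ 1) //; try lra.
  by rewrite Rmult_1_r; congr (f _ _ * _); field; lra.
have E : Rabs (A N - ln (INR N) * S N) <= M * INR N.
  by apply: sum_ln_weighted_le => //; lia.
have D0 : 0 < c * INR N * ln (INR N) by do 2 (apply: Rmult_lt_0_compat; try lra).
have -> : / c * (S N / INR N) = ln (INR N) * S N / (c * INR N * ln (INR N)).
  by field; lra.
have -> : M / c * / ln (INR N) = M * INR N / (c * INR N * ln (INR N)).
  by field; lra.
have [lo hi] := proj1 (Rabs_le_between _ _) E.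
rewrite /Rdiv -Rmult_minus_distr_r -Rmult_plus_distr_r.
split; apply: Rmult_le_compat_r; try lra; exact/Rlt_le/Rinv_0_lt_compat.
Qed.
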